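(* Let $I=[0,1]$ and $F=F_{\{1/2,3\}}=\{(x,3x):x\in[0,\tfrac13]\}\cup\{(x,\tfrac x2):x\in[0,1]\}\subseteq I^2$. Then the dynamical system $(I_F^+,\sigma_F^+)$ does not have the specification property.
   Context: $I_F^+=\{(x_1,x_2,\ldots)\in I^{\mathbb N}: (x_i,x_{i+1})\in F\ \forall i\ge 1\}$, with metric $D(\mathbf x,\mathbf y)=\sup_{i\ge1}|x_i-y_i|/2^i$, and $\sigma_F^+(x_1,x_2,\ldots)=(x_2,x_3,\ldots)$. Let $(Y,f)$ be a dynamical system ($Y$ compact metric with metric $d$, $f:Y\to Y$ continuous). A specification consists of $n\ge1$, points $x_1,\ldots,x_n\in Y$, and non-negative integers $k_j\le \ell_j$ ($1\le j\le n$), representing the orbit segments $(f^{k_j}(x_j),\ldots,f^{\ell_j}(x_j))$. It is $N$-spaced if $k_{j+1}-\ell_j\ge N$ for $1\le j\le n-1$. It is $\varepsilon$-traced by $y\in Y$ if $d(f^j(y),f^j(x_i))\le\varepsilon$ for all $1\le i\le n$ and $k_i\le j\le \ell_i$. $(Y,f)$ has the specification property if for each $\varepsilon>0$ there is a positive integer $N$ such that every $N$-spaced specification is $\varepsilon$-traced by some $y\in Y$. *)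

(* Defs.v *)
From HB Require Import structures.
From mathcomp Require Import all_boot all_order all_algebra.
From mathcomp Require Import all_classical all_reals all_analysis.
From mathcomp Require Import lra.

Set Implicit Arguments.
Unset Strict Implicit.
Unset Printing Implicit Defensive.

Import Order.TTheory GRing.Theory Num.Theory.
Import numFieldTopology.Exports numFieldNormedType.Exports.

Local Open Scope classical_set_scope.
Local Open Scope ring_scope.

Record dynamical_system (R : realType) := DynamicalSystem {
  ds_space :> metricType R;
  ds_map : ds_space -> ds_space;
  ds_compact : compact [set: ds_space];
  ds_continuous : continuous ds_map }.

Record specification (Y : Type) := Specification {
  spec_size : nat;
  spec_size_gt0 : (0 < spec_size)%N;
  spec_point : 'I_spec_size -> Y;
  spec_start : 'I_spec_size -> nat;
  spec_stop : 'I_spec_size -> nat;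
  spec_start_le_stop : forall i, (spec_start i <= spec_stop i)%N }.

Section Specification.
Variables (R : realType) (S : dynamical_system R).

(* [k_{j+1} - l_j >= N] is written additively: subtraction on [nat] is
   truncated. *)
Definition spaced (N : nat) (s : specification S) : Prop :=
  forall i j : 'I_(spec_size s), j = i.+1 :> nat ->
    (spec_stop i + N <= spec_start j)%N.

Definition traced (eps : R) (s : specification S) (y : S) : Prop :=
  forall (i : 'I_(spec_size s)) (j : nat),
    (spec_start i <= j <= spec_stop i)%N ->
    mdist (iter j (@ds_map R S) y) (iter j (@ds_map R S) (spec_point i))
      <= eps.

Definition specification_property : Prop :=
  forall eps : R, 0 < eps -> exists2 N : nat, (0 < N)%N &
    forall s : specification S, spaced N s -> exists y : S, traced eps s y.

End Specification.

(* Sequences are indexed from 0: [x i] stands for the coordinate [x_{i+1}]. *)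
Definition forward_set (R : realType) (F : set (R * R)) : set (nat -> R) :=
  [set x | (forall i, x i \in `[0, 1]) /\ (forall i, F (x i, x i.+1))].

Record forward_space (R : realType) (F : set (R * R)) := ForwardSeq {
  forward_seq :> nat -> R;
  forward_seqP : forward_set F forward_seq }.

Definition forward_dist (R : realType) (F : set (R * R))
    (x y : forward_space F) : R :=
  sup (range (fun i => `|x i - y i| / 2 ^+ i.+1)).

HB.instance Definition _ (R : realType) (F : set (R * R)) :=
  gen_eqMixin (forward_space F).
HB.instance Definition _ (R : realType) (F : set (R * R)) :=
  gen_choiceMixin (forward_space F).

Lemma continuous_pair_fun (T U V : topologicalType) (f : T -> U) (g : T -> V) :
  continuous f -> continuous g -> continuous (fun x => (f x, g x)).
Proof. by move=> cf cg x; exact: (cvg_pair (cf x) (cg x)). Qed.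

Section ForwardSpace.
Variables (R : realType) (F : set (R * R)).
Implicit Types x y z : forward_space F.

Lemma forward_le1 x y i : `|x i - y i| <= 1.
Proof.
have [+ _] := forward_seqP x; move=> /(_ i); rewrite in_itv/= => /andP[x0 x1].
have [+ _] := forward_seqP y; move=> /(_ i); rewrite in_itv/= => /andP[y0 y1].
by rewrite ler_norml; apply/andP; split; lra.
Qed.

Lemma forward_term_le x y i :
  `|x i - y i| / 2 ^+ i.+1 <= forward_dist x y.
Proof.
apply: ub_le_sup; last by exists i.
exists 1 => _ [j _ <-]; rewrite ler_pdivrMr ?exprn_gt0// mul1r.
by rewrite (le_trans (forward_le1 x y j))// exprn_ege1// ler1n.
Qed.

Lemma forward_dist_le x y (c : R) :
  (forall i, `|x i - y i| / 2 ^+ i.+1 <= c) -> forward_dist x y <= c.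
Proof.
move=> h; apply: ge_sup; first by exists (`|x 0%N - y 0%N| / 2 ^+ 1); exists 0%N.
by move=> _ [i _ <-].
Qed.

Lemma forward_distxx x : forward_dist x x = 0.
Proof.
apply/eqP; rewrite eq_le; apply/andP; split.
  by apply: forward_dist_le => i; rewrite subrr normr0 mul0r.
by apply: le_trans (forward_term_le x x 0); rewrite divr_ge0.
Qed.

Lemma forward_dist_eq0 x y : forward_dist x y = 0 -> x = y.
Proof.
move=> d0; have xy : x = y :> (nat -> R).
  apply/funext => i; have := forward_term_le x y i.
  by rewrite d0 pmulr_lle0 ?invr_gt0 ?exprn_gt0// normr_le0 subr_eq0 => /eqP.
case: x y xy {d0} => [x xF] [y yF] /= xy; case: _ / xy in yF *.
by congr ForwardSeq; exact: Prop_irrelevance.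
Qed.

Lemma forward_dist_sym x y : forward_dist x y = forward_dist y x.
Proof. by congr sup; congr image; apply/funext => i; rewrite distrC. Qed.

Lemma forward_dist_triangle y x z :
  forward_dist x z <= forward_dist x y + forward_dist y z.
Proof.
apply: forward_dist_le => i.
apply: le_trans (lerD (forward_term_le x y i) (forward_term_le y z i)).
by rewrite -mulrDl ler_pM2r ?invr_gt0 ?exprn_gt0// ler_distD.
Qed.

HB.instance Definition _ := isMetric.Build R (forward_space F)
  forward_distxx forward_dist_eq0 forward_dist_sym forward_dist_triangle.

Lemma forward_set_shift (x : nat -> R) :
  forward_set F x -> forward_set F (fun i => x i.+1).
Proof. by move=> [xI xF]; split => i. Qed.

Definition forward_shift x : forward_space F :=
  ForwardSeq (forward_set_shift (forward_seqP x)).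

Lemma forward_shift_lipschitz x y :
  forward_dist (forward_shift x) (forward_shift y) <= 2 * forward_dist x y.
Proof.
apply: forward_dist_le => i /=.
rewrite -ler_pdivrMl//; apply: le_trans (forward_term_le x y i.+1).
by rewrite [in leRHS]exprS invfM mulrCA.
Qed.

Lemma forward_shift_continuous : continuous forward_shift.
Proof.
move=> x A /nbhs_ballP[e /= e0 eA]; apply/nbhs_ballP.
exists (e / 2) => [|y]; first by rewrite /= divr_gt0.
rewrite ballEmdist/= => xy; apply: eA; rewrite ballEmdist/=.
apply: (le_lt_trans (forward_shift_lipschitz x y)).
by rewrite mulrC -ltr_pdivlMr.
Qed.

Hypothesis F_closed : closed F.

Lemma forward_set_compact :
  @compact (prod_topology (fun _ : nat => R)) (forward_set F).
Proof.
apply: (subclosed_compact _ (@tychonoff nat (fun=> R) (fun=> `[0, 1]%classic) _)).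
- rewrite (_ : forward_set F =
    [set x : prod_topology (fun _ : nat => R) | forall i, x i \in `[0, 1]]
    `&` [set x | forall i, F (x i, x i.+1)]); last by [].
  apply: closedI.
  + rewrite (_ : [set _ | _] = \bigcap_i
      ((fun x : prod_topology (fun _ : nat => R) => x i) @^-1` `[0, 1]%classic)).
      apply: closed_bigI => i _; apply: preimage_closed; last exact: interval_closed.
      by move=> x _; exact: (@proj_continuous nat (fun=> R) i x).
    by apply/seteqP; split => x /= h i => [_|]; exact: h.
  + rewrite (_ : [set _ | _] = \bigcap_i
      ((fun x : prod_topology (fun _ : nat => R) => (x i, x i.+1)) @^-1` F)).
      apply: closed_bigI => i _; apply: preimage_closed => // x _.
      have ci : continuous (fun x : prod_topology (fun _ : nat => R) => x i).
        exact: (@proj_continuous nat (fun=> R) i).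
      have ci1 : continuous (fun x : prod_topology (fun _ : nat => R) => x i.+1).
        exact: (@proj_continuous nat (fun=> R) i.+1).
      have c := continuous_pair_fun ci ci1.
      exact: c.
    by apply/seteqP; split => x /= h i => [_|]; exact: h.
- by move=> _; exact: segment_compact.
- by move=> x [xI _] i; exact: xI.
Qed.

Lemma forward_space_compact : compact [set: forward_space F].
Proof.
move=> G GG _.
have GGv : ProperFilter (@forward_seq R F @ G).
  exact: fmap_proper_filter.
have Gs : (@forward_seq R F @ G) (forward_set F).
  by apply: (@filterS _ G) filterT => x _; exact: forward_seqP.
have [p [Fp clp]] := forward_set_compact GGv Gs.
exists (ForwardSeq Fp); split=> // A B GA.
move=> /nbhs_ballP[e /= e0 eB].
have [N Ne] : exists N, forall i, (N <= i)%N -> 1 / 2 ^+ i.+1 < e / 2 :> R.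
  have [N _ NP] := near_infty_natSinv_expn_lt (PosNum (divr_gt0 e0 (ltr0Sn R 1))).
  exists N => i Ni; apply: le_lt_trans (NP i Ni).
  by rewrite !div1r lef_pV2 ?posrE ?exprn_gt0// ler_eXn2l// ltr1n.
pose T : topologicalType := prod_topology (fun _ : nat => R).
pose U : set T :=
  [set u | forall i : 'I_N, ball (p i) (e / 2) (u i)].
have Up : nbhs (p : T) U.
  apply: (@filter_forall T 'I_N (fun i u => ball (p i) (e / 2) (u i)) _
    (nbhs_filter (p : T))) => i.
  have ci : continuous (fun u : T => u i).
    exact: (@proj_continuous nat (fun=> R) i).
  by apply: (ci p); apply: nbhsx_ballx; rewrite divr_gt0.
have GvA : (@forward_seq R F @ G) (@forward_seq R F @` A).
  by apply: (@filterS _ G) GA => x Ax; exists x.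
have [_ [[y Ay <-] Uy]] := clp _ _ GvA Up.
exists y; split=> //; apply: eB; rewrite ballEmdist/=.
apply: (@le_lt_trans _ _ (e / 2)); last by rewrite ltr_pdivrMr// ltr_pMr// ltr1n.
apply: forward_dist_le => i /=; have [Ni|iN] := leqP N i.
  apply: le_trans (ltW (Ne i Ni)).
  by rewrite ler_pM2r ?invr_gt0 ?exprn_gt0// (forward_le1 (ForwardSeq Fp) y i).
have := Uy (Ordinal iN); rewrite /ball/= => /ltW; apply: le_trans.
by rewrite ler_pdivrMr ?exprn_gt0// ler_peMr// exprn_ege1// ler1n.
Qed.

Definition forward_system : dynamical_system R :=
  DynamicalSystem forward_space_compact forward_shift_continuous.

End ForwardSpace.

Definition F_half_three (R : realType) : set (R * R) :=
  [set (x, 3 * x) | x in `[0, 1/3]] `|` [set (x, x / 2) | x in `[0, 1]].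
Arguments F_half_three R : clear implicits.

Lemma F_half_three_closed (R : realType) : closed (F_half_three R).
Proof.
have cl (f : R -> R * R) (a b : R) : continuous f -> closed (f @` `[a, b]).
  move=> cf; apply: compact_closed; first exact: norm_hausdorff.
  apply: continuous_compact; last exact: segment_compact.
  exact: continuous_subspaceT.
apply: closedU; apply: cl; apply: continuous_pair_fun => x.
- exact: cvg_id.
- exact: mulrl_continuous.
- exact: cvg_id.
- exact: mulrr_continuous.
Qed.
Arguments F_half_three_closed R : clear implicits.

(* Main.v *)
(* Along an orbit [x] every step multiplies by [3] or by [1/2], so
   [x n * 2 ^ n = 6 ^ a * x 0] for some [a]: for a fixed gap [n], the ratios
   [x n / x 0] lie on a single geometric progression of ratio [6]. An orbit
   passing near [1] and, [N] steps later, near [1], and another one passing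
   near [1] and, [N] steps later, near [1/2], would yield two such ratios
   whose quotient is close to [2]. *)
Require Import Defs.
From mathcomp Require Import all_boot all_order all_algebra.
From mathcomp Require Import all_classical all_reals all_analysis.
From mathcomp Require Import lra.

Set Implicit Arguments.
Unset Strict Implicit.
Unset Printing Implicit Defensive.

Import Order.TTheory GRing.Theory Num.Theory.

Local Open Scope classical_set_scope.
Local Open Scope ring_scope.

Lemma iter_forward_shift (R : realType) (F : set (R * R))
    (x : forward_space F) j i :
  iter j (@forward_shift R F) x i = x (j + i)%N.
Proof. by elim: j i => [//|j IH] i; rewrite iterS /= IH addnS. Qed.

(** A halving step leaves [x n * 2 ^+ n] unchanged and a tripling step multiplies it by 6, so [a]
    counts the triplings. *)
Lemma half_three_orbit (R : realType) (x : forward_space (F_half_three R)) n :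
  exists a, x n * 2 ^+ n = 6 ^+ a * x 0%N.
Proof.
elim: n => [|n [a IH]]; first by exists 0%N; rewrite !expr0 mulr1 mul1r.
have [_ /(_ n)] := forward_seqP x.
case=> -[u _ [uE vE]].
- exists a.+1; rewrite -vE uE (exprS 6) -mulrA -IH exprS; lra.
- by exists a; rewrite -IH -vE uE exprS mulrA divfK.
Qed.

(** An orbit that triples up to the value [t] at time [N], then halves forever. Since subtraction
    truncates, at most one exponent is nonzero at each index. *)
Definition rise_fall (R : realType) (N : nat) (t : R) : nat -> R :=
  fun i => t / 3 ^+ (N - i) / 2 ^+ (i - N).

Lemma rise_fall_at (R : realType) N (t : R) : rise_fall N t N = t.
Proof. by rewrite /rise_fall subnn !expr0 !divr1. Qed.

Lemma rise_fall_forward (R : realType) N (t : R) : 0 <= t <= 1 ->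
  forward_set (F_half_three R) (rise_fall N t).
Proof.
move=> /andP[t0 t1].
have le_t (a : R) k : 1 <= a -> 0 <= t / a ^+ k <= 1.
  move=> a1; have ak := exprn_ege1 k a1.
  have ak0 := lt_le_trans ltr01 ak.
  by rewrite divr_ge0 ?(ltW ak0)//= ler_pdivrMr// mul1r (le_trans t1).
have I i : 0 <= rise_fall N t i <= 1.
  rewrite /rise_fall; case: (leqP N i) => [Ni|/ltnW iN].
    by rewrite (eqP Ni) expr0 divr1 le_t ?ler1n.
  by rewrite (eqP iN) expr0 divr1 le_t ?ler1n.
split=> i; first by rewrite in_itv /= I.
case: (ltnP i N) => [iN|Ni].
- left; exists (rise_fall N t i).
    (* The tripling branch requires a value at most [1/3]; this follows from the next value, its
       triple, being at most 1. *)
    have := I i.+1; rewrite /= in_itv /= /rise_fall.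
    rewrite (eqP (ltnW iN)) (eqP iN) !expr0 !divr1 -(subnSK iN) exprS invfM.
    lra.
  congr (_, _); rewrite /rise_fall (eqP (ltnW iN)) (eqP iN) !expr0 !divr1.
  by rewrite -(subnSK iN) exprS invfM mulrCA mulVKf.
- right; exists (rise_fall N t i); first by rewrite /= in_itv /= I.
  congr (_, _); rewrite /rise_fall (eqP Ni) (eqP (leqW Ni)) !expr0 !divr1.
  by rewrite subSn// exprSr invfM mulrA.
Qed.

(** Trace two one-point segments, at times 0 and [N]. The factor 2 undoes the weight [1/2] of the
    first coordinate in the metric. *)
Lemma specification_half_three_pair (R : realType) (eps t : R) (N : nat)
    (S := forward_system (F_half_three_closed R)) :
  0 <= t <= 1 ->
  (forall s : specification S, spaced N s -> exists y : S, traced eps s y) ->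
  exists y : forward_space (F_half_three R),
    `|y 0%N - 1| <= 2 * eps /\ `|y N - t| <= 2 * eps.
Proof.
move=> t01 trace.
have one01 : 0 <= (1 : R) <= 1 by rewrite ler01 lexx.
pose p : S := ForwardSeq (rise_fall_forward 0 one01).
pose q : S := ForwardSeq (rise_fall_forward N t01).
pose k (i : 'I_2) : nat := if i == ord0 then 0%N else N.
pose s := @Specification S 2 isT (fun i => if i == ord0 then p else q) k k
  (fun i => leqnn (k i)).
have [|y ytr] := trace s.
  by case=> [[|[|i]] hi] [[|[|j]] hj].
have near (x : S) j : mdist (iter j (@ds_map R S) y)
    (iter j (@ds_map R S) x) <= eps ->
    `|(y : forward_space _) j - (x : forward_space _) j| <= 2 * eps.
  move=> d; have := le_trans (forward_term_le _ _ 0) d.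
  by rewrite !iter_forward_shift addn0 expr1 ler_pdivrMr// mulrC.
exists y; split.
- by have := near p 0%N (ytr ord0 0%N isT); rewrite /= rise_fall_at.
- have /near : mdist (iter N (@ds_map R S) y) (iter N (@ds_map R S) q) <= eps.
    by apply: (ytr (ord_max : 'I_2)); rewrite /= /k /= leqnn.
  by rewrite /= rise_fall_at.
Qed.

Theorem corollary5p4 (R : realType) :
  ~ specification_property
    (@forward_system R (F_half_three R) (F_half_three_closed R)).
Proof.
move=> /(_ (1 / 20)) [|N _ trace]; first by lra.
have [|y [y0 yN]] := specification_half_three_pair (t := 1) _ trace.
  by rewrite ler01 lexx.
have [|z [z0 zN]] := specification_half_three_pair (t := 1 / 2) _ trace.
  by apply/andP; split; lra.
have [[yI _] [zI _]] := (forward_seqP y, forward_seqP z).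
move: (yI 0%N) (yI N) (zI 0%N); rewrite !in_itv /= => yI0 yIN zI0.
have [[a ya] [b zb]] := (half_three_orbit y N, half_three_orbit z N).
move: y0 yN z0 zN ya zb yI0 yIN zI0; rewrite !ler_norml.
move: (y 0%N) (y N) (z 0%N) (z N) => y0 yN z0 zN.
move=> y0n yNn z0n zNn ya zb y01 yN1 z01.
(* Eliminating [2 ^+ N] makes [z0 * yN / (y0 * zN)] an integer power of 6. *)
have cross : 6 ^+ a * (y0 * zN) = 6 ^+ b * (z0 * yN).
  apply: (mulIf (expf_neq0 N (_ : (2 : R) != 0))) => //.
  by rewrite mulrA -ya [in RHS]mulrA -zb; lra.
(* With errors at most [1/10], this quotient lies strictly between 1 and 6, where there is no power
   of 6. *)
have lo : y0 * zN < z0 * yN by nra.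
have hi : z0 * yN < 6 * (y0 * zN) by nra.
have pos k : 0 < 6 ^+ k :> R by exact: exprn_gt0.
case: (leqP a b) => [|ba].
- move=> /(ler_weXn2l (ler1n R 6)); have := pos a; have := pos b; nra.
- have := ler_weXn2l (ler1n R 6) ba; rewrite exprS.
  have := pos a; have := pos b; nra.
Qed.
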